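(* Let $F$ be a field. Then the following statements are equivalent. (a) For every $n\in\mathbb{N}$ and any distinct indeterminates $x_1,\dots,x_n$, the polynomial ring $F[x_1,\dots,x_n]$ is hereditarily atomic. (b) The polynomial ring $F[x]$ in one indeterminate is hereditarily atomic. (c) $F$ is an algebraic extension of $\mathbb{F}_p$ for some prime $p$.
   Context: $\mathbb{N}$ is the set of positive integers. An integral domain is atomic if every nonzero nonunit element factors into (finitely many) irreducible elements. An integral domain $R$ is hereditarily atomic if every subring of $R$ (with the same identity) is atomic. *)

(* Defs.v *)
From HB Require Import structures.
From mathcomp Require Import all_boot all_order all_algebra.
From mathcomp Require Import mpoly.
Set Implicit Arguments.
Unset Strict Implicit.
Unset Printing Implicit Defensive.
Import GRing.Theory.
Local Open Scope ring_scope.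

(* Subrings are arbitrary Prop-valued predicates (not boolean ones), so that   *)
(* undecidable subrings are included; they share the identity of R. Units,     *)
(* irreducibles and factorizations below are those of the subring S itself:    *)
(* an irreducible of S need not be irreducible in R.                           *)
Definition is_subring (R : idomainType) (S : R -> Prop) : Prop :=
  [/\ S 1,
      forall x y, S x -> S y -> S (x - y)
    & forall x y, S x -> S y -> S (x * y)].

Definition unit_in (R : idomainType) (S : R -> Prop) (u : R) : Prop :=
  S u /\ exists2 v, S v & u * v = 1.

Definition irreducible_in (R : idomainType) (S : R -> Prop) (a : R) : Prop :=
  [/\ S a, a <> 0, ~ unit_in S a
    & forall b c, S b -> S c -> a = b * c -> unit_in S b \/ unit_in S c].

Definition atomic_in (R : idomainType) (S : R -> Prop) : Prop :=
  forall a, S a -> a <> 0 -> ~ unit_in S a ->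
  exists2 s : seq R, (forall b, b \in s -> irreducible_in S b)
                   & a = \prod_(b <- s) b.

Definition hereditarily_atomic (R : idomainType) : Prop :=
  forall S : R -> Prop, is_subring S -> atomic_in S.

(* For p prime, the embedding of 'F_p is unique, and it exists exactly when F  *)
(* has characteristic p.                                                       *)
Definition algebraic_over_Fp (p : nat) (F : fieldType) : Prop :=
  exists iota : {rmorphism 'F_p -> F}, forall x : F, algebraicOver iota x.

(* Main.v *)
Require Import Defs.
From HB Require Import structures.
From mathcomp Require Import all_boot all_order all_algebra.
From mathcomp Require Import finfield.
From mathcomp Require Import mpoly.
From Stdlib Require Import Classical_Prop.
Set Implicit Arguments.
Unset Strict Implicit.
Unset Printing Implicit Defensive.
Import GRing.Theory.
Local Open Scope ring_scope.

(** The bridge between the three conditions is a fourth one, a property of the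
    field [F] alone: in every subring of [F], all nonzero elements are units
    ([subrings_are_fields F]).

    If [F[x]] is hereditarily atomic, then [F] has this property.  Suppose that
    [a] is a nonzero nonunit of a subring [A] of [F], and consider the subring
    [A + x F[x]] of [F[x]].  Any factorization of [x] in it has a factor [b]
    with constant coefficient [0], and then [b = a * (a^-1 b)] is a product of
    two nonunits of [A + x F[x]]; so [x] has no factorization into
    irreducibles ([hereditarily_atomic_poly_subrings]).

    A field with this property is algebraic over a prime field of positive
    characteristic.  The image of the integers being a field, [2] is zero or
    invertible in it, so that [2] itself or an odd integer vanishes in [F];
    hence the characteristic is a prime [p].  For [x] nonzero in [F], the image
    of [F_p[X]] under evaluation at [x] is a field, so [x^-1 = q(x)] for some
    [q], and [x] is a root of [X q - 1] ([subrings_are_fields_algebraic]).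

    Conversely, an algebraic extension of [F_p] has the property, because an
    algebraic relation satisfied by [c] expresses [c^-1] as a polynomial in [c]
    with coefficients in [F_p] ([algebraic_subrings_are_fields]).  Then, in any
    subring of [F[x_1, ..., x_n]], the nonzero constants are units, so that
    nonzero nonunits have positive degree; the degree being additive, one can
    split an element into nonunits only finitely many times
    ([atomic_in_degree]).

    Finally [F[x]] embeds in [F[x_1]], and being hereditarily atomic passes to
    subrings ([hereditarily_atomic_inj]). *)

(** * Subrings *)

Section Subring.

Variables (R : idomainType) (S : R -> Prop).
Hypothesis ringS : is_subring S.

Lemma subring0 : S 0.
Proof. by case: ringS => S1 SB _; rewrite -(subrr 1); apply: SB. Qed.

Lemma subringN x : S x -> S (- x).
Proof. by case: ringS => _ SB _ Sx; rewrite -sub0r; apply/SB/Sx/subring0. Qed.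

Lemma subringD x y : S x -> S y -> S (x + y).
Proof.
by case: ringS => _ SB _ Sx Sy; rewrite -[y]opprK; apply/SB/subringN.
Qed.

Lemma subring_nat n : S n%:R.
Proof.
case: ringS => S1 _ _; elim: n => [|n IHn]; first exact: subring0.
by rewrite mulrSr; apply: subringD.
Qed.

End Subring.

Lemma subring_image (R1 R2 : idomainType) (f : {rmorphism R1 -> R2})
    (S : R1 -> Prop) :
  is_subring S -> is_subring (fun y => exists2 x, S x & y = f x).
Proof.
case=> S1 SB SM; split.
- by exists 1; rewrite ?rmorph1.
- by move=> _ _ [x Sx ->] [y Sy ->]; exists (x - y); rewrite ?rmorphB; auto.
- by move=> _ _ [x Sx ->] [y Sy ->]; exists (x * y); rewrite ?rmorphM; auto.
Qed.

Lemma subring_preimage (R1 R2 : idomainType) (f : {rmorphism R1 -> R2})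
    (S : R2 -> Prop) :
  is_subring S -> is_subring (fun x => S (f x)).
Proof.
case=> S1 SB SM; split; first by rewrite rmorph1.
- by move=> x y Sx Sy; rewrite rmorphB; apply: SB.
- by move=> x y Sx Sy; rewrite rmorphM; apply: SM.
Qed.

(** A subring of [R1] is isomorphic to its image in [R2]; being a unit,
    irreducible or a product of irreducibles only depends on the subring. *)
Lemma hereditarily_atomic_inj (R1 R2 : idomainType)
    (f : {rmorphism R1 -> R2}) :
  injective f -> hereditarily_atomic R2 -> hereditarily_atomic R1.
Proof.
move=> inj_f atomR2 S ringS a Sa a0 Na.
pose fS y := exists2 x, S x & y = f x.
have fS_unit u : S u -> unit_in fS (f u) -> unit_in S u.
  move=> Su [_ [_ [v Sv ->] uv1]]; split=> //; exists v => //.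
  by apply: inj_f; rewrite rmorphM rmorph1.
have unit_fS u : unit_in S u -> unit_in fS (f u).
  case=> Su [v Sv uv1]; split; first by exists u.
  by exists (f v); [exists v | rewrite -rmorphM uv1 rmorph1].
have [|||s irr_s def_fa] := atomR2 _ (subring_image f ringS) (f a).
- by exists a.
- by rewrite -(rmorph0 f) => /inj_f.
- by move/(fS_unit a Sa).
have [t [St def_s]] : exists t, (forall b, b \in t -> S b) /\ s = map f t.
  elim: s irr_s {def_fa} => [|c s IHs] irr_s; first by exists [::].
  have [b bs|t [St ->]] := IHs; first by apply: irr_s; rewrite inE bs orbT.
  have [[d Sd ->] _ _ _] := irr_s c (mem_head _ _).
  by exists (d :: t); split=> // b; rewrite inE => /predU1P[->|/St].
exists t => [b tb|]; last first.
  by apply: inj_f; rewrite def_fa def_s big_map rmorph_prod.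
have [|_ b0 Nb irr_b] := irr_s (f b); first by rewrite def_s map_f.
split; first exact: St.
- by move=> b_eq0; apply: b0; rewrite b_eq0 rmorph0.
- by move/unit_fS.
- move=> c d Sc Sd def_b.
  have [|||/fS_unit|/fS_unit] := irr_b (f c) (f d).
  + by exists c.
  + by exists d.
  + by rewrite def_b rmorphM.
  + by auto.
  + by auto.
Qed.

(** Splitting an element into two nonunits strictly decreases [deg], as both
    parts have positive degree; so the splitting terminates. *)
Lemma atomic_in_degree (R : idomainType) (S : R -> Prop) (deg : R -> nat) :
    (forall b c, b != 0 -> c != 0 -> deg (b * c) = (deg b + deg c)%N) ->
    (forall b, S b -> b != 0 -> deg b = 0 -> unit_in S b) ->
  atomic_in S.
Proof.
move=> degM deg0_unit a; have [n] := ubnP (deg a).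
elim: n a => // n IHn a le_an Sa a0 Na.
have [irr_a|] := classic (irreducible_in S a).
  by exists [:: a]; rewrite ?big_seq1 // => b; rewrite inE => /eqP->.
move=> red_a; have [b [c [Sb Sc def_a Nb Nc]]] : exists b c,
    [/\ S b, S c, a = b * c, ~ unit_in S b & ~ unit_in S c].
  apply: NNPP => no_bc; apply: red_a; split=> // b c Sb Sc def_a.
  have [|Nb] := classic (unit_in S b); first by left.
  have [|Nc] := classic (unit_in S c); first by right.
  by case: no_bc; exists b, c.
have /norP[b0 c0] : ~~ ((b == 0) || (c == 0)).
  by rewrite -mulf_eq0 -def_a; apply/eqP.
have deg_gt0 x : S x -> x != 0 -> ~ unit_in S x -> (0 < deg x)%N.
  by move=> Sx x0 Nx; rewrite lt0n; apply/eqP => /(deg0_unit x Sx x0).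
have := deg_gt0 b Sb b0 Nb; have := deg_gt0 c Sc c0 Nc => degc degb.
move: le_an; rewrite def_a degM // ltnS => le_bc_n.
have [||s irr_s ->] := IHn b _ Sb _ Nb; last 1 first.
have [||t irr_t ->] := IHn c _ Sc _ Nc; last 1 first.
- exists (s ++ t); last by rewrite big_cat.
  by move=> x; rewrite mem_cat => /orP[/irr_s|/irr_t].
- by apply: leq_trans le_bc_n; rewrite -[deg c]add0n ltn_add2r.
- exact/eqP.
- by apply: leq_trans le_bc_n; rewrite -[ltnLHS]addn0 ltn_add2l.
- exact/eqP.
Qed.

(** * Fields all of whose subrings are fields *)

Definition subrings_are_fields (F : fieldType) : Prop :=
  forall A : F -> Prop, is_subring A ->
  forall a, A a -> a != 0 -> unit_in A a.

(** If [a] is a nonzero nonunit of [A], then no factorization of ['X] into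
    irreducibles exists in the subring [A + 'X * {poly F}]: a factor without
    constant coefficient is divisible by [a]. *)
Lemma hereditarily_atomic_poly_subrings (F : fieldType) :
  hereditarily_atomic {poly F} -> subrings_are_fields F.
Proof.
move=> atomFX A ringA a Aa a0; apply: NNPP => Na.
have A0 := subring0 ringA; have [A1 AB AM] := ringA.
pose S (f : {poly F}) := A f`_0.
have ringS : is_subring S.
  split; rewrite /S; first by rewrite coefC.
  - by move=> f g Sf Sg; rewrite coefB; apply: AB.
  - by move=> f g Sf Sg; rewrite coef0M; apply: AM.
have nonunit_coef0 (f : {poly F}) : f`_0 = 0 -> ~ unit_in S f.
  move=> f0 [_ [g _ /(congr1 (fun h : {poly F} => h`_0))]].
  by rewrite coef0M f0 mul0r coefC => /esym/eqP; rewrite oner_eq0.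
have [|||s irr_s defX] := atomFX S ringS 'X.
- by rewrite /S coefX.
- by apply/eqP; rewrite polyX_eq0.
- by apply: nonunit_coef0; rewrite coefX.
have [b sb b0] : exists2 b, b \in s & b`_0 = 0.
  have /eqP : ('X : {poly F})`_0 = 0 by rewrite coefX.
  rewrite defX coef0_prod prodf_seq_eq0 => /hasP[b sb /eqP b0].
  by exists b.
have [_ _ _ irr_b] := irr_s b sb.
have [||| |] := irr_b a%:P (a^-1 *: b).
- by rewrite /S coefC.
- by rewrite /S coefZ b0 mulr0.
- by rewrite mul_polyC scalerA mulfV ?scale1r.
- case=> _ [g Sg /(congr1 (fun h : {poly F} => h`_0))].
  by rewrite coef0M !coefC /= => ag1; apply: Na; split=> //; exists g`_0.
- by apply: nonunit_coef0; rewrite coefZ b0 mulr0.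
Qed.

Lemma subrings_are_fields_pchar (F : fieldType) :
  subrings_are_fields F -> exists p, p \in [pchar F].
Proof.
move=> subF.
have [F2|F2] := eqVneq (2%:R : F) 0.
  by apply: (@natf0_pchar _ 2) => //; apply/eqP.
have ringZ : is_subring (fun _ : int => True) by [].
have [||_ [_ [m _ ->]]] := subF _ (subring_image intr ringZ) 2%:R.
- by exists 2%:R; rewrite ?rmorph_nat.
- exact: F2.
(* The integer [2 m - 1] vanishes in [F] but, being odd, is not [0]. *)
move=> F2m; pose k : int := 2%:R * m - 1.
have k0 : k != 0.
  rewrite subr_eq0; apply/eqP => /(congr1 absz).
  by rewrite abszM => /(congr1 odd); rewrite oddM.
have : k%:~R == 0 :> F by rewrite rmorphB rmorphM /= F2m subrr.
rewrite -absz_gt0 in k0 => Fk; apply: (natf0_pchar k0); move: Fk.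
by case: (k) => j //; rewrite NegzE mulrNz oppr_eq0.
Qed.

Lemma subrings_are_fields_algebraic (F : fieldType) :
  subrings_are_fields F -> exists2 p : nat, prime p & algebraic_over_Fp p F.
Proof.
move=> subF; have [p pcharFp] := subrings_are_fields_pchar subF.
exists p; first exact: pcharf_prime pcharFp.
have [iota] : inhabited {rmorphism 'F_p -> F}.
  pose in_F : {rmorphism 'F_p -> pPrimeCharType pcharFp} := in_alg _.
  by split; exact: in_F.
exists iota => x; have [->|x0] := eqVneq x 0; first exact: algebraic0.
pose ev_x : {rmorphism {poly 'F_p} -> F} := horner_eval x \o map_poly iota.
have ringT : is_subring (fun _ : {poly 'F_p} => True) by [].
have [||_ [_ [q _ ->] xq1]] := subF _ (subring_image ev_x ringT) x.
- by exists 'X; rewrite //= map_polyX /horner_eval hornerX.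
- exact: x0.
exists ('X * q - 1).
  apply/eqP => /(congr1 (fun h : {poly 'F_p} => h`_0))/eqP.
  by rewrite coefB coef0M coefX coefC mul0r sub0r coef0 oppr_eq0 oner_eq0.
rewrite /root rmorphB rmorphM rmorph1 /= map_polyX.
by rewrite !hornerE; apply/eqP; rewrite -[X in _ - X]xq1 subrr.
Qed.

(** Dividing an annihilating polynomial of [x] by the largest possible power
    of the variable makes its constant coefficient nonzero; once it has the
    form ['X * q + k%:P] with [k != 0], [x^-1 = (- k^-1 *: q).[x]]. *)
Lemma algebraic_inverse_polynomial (K F : fieldType)
    (iota : {rmorphism K -> F}) (x : F) :
    x != 0 -> algebraicOver iota x ->
  exists r : {poly K}, x * (map_poly iota r).[x] = 1.
Proof.
move=> x0 [p]; elim/poly_ind: p => [|q k IHq]; first by rewrite eqxx.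
move=> p0; rewrite rmorphD rmorphM /= map_polyX map_polyC /=.
rewrite /root !hornerE => qx.
have [k0|k0] := eqVneq k 0.
  move: qx p0; rewrite k0 rmorph0 !addr0 mulf_eq0 (negPf x0) orbF => qx.
  by rewrite mulf_eq0 negb_or => /andP[q0 _]; apply: IHq.
exists (- k^-1 *: q); rewrite linearZ /= hornerZ rmorphN fmorphV.
move: qx; rewrite addr_eq0 => /eqP qx.
by rewrite mulrCA [x * _]mulrC qx mulrNN mulVf // fmorph_eq0.
Qed.

(** The coefficients of the polynomial that expresses the inverse of [a] come
    from ['F_p], so they are multiples of [1] and lie in every subring. *)
Lemma algebraic_subrings_are_fields (p : nat) (F : fieldType) :
  algebraic_over_Fp p F -> subrings_are_fields F.
Proof.
case=> iota algF A ringA a Aa a0; split=> //.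
have [r ar1] := algebraic_inverse_polynomial a0 (algF a).
exists (map_poly iota r).[a] => //; have [_ _ AM] := ringA.
elim/poly_ind: r {ar1} => [|q k Aq].
  by rewrite rmorph0 horner0; apply: subring0.
rewrite rmorphD rmorphM /= map_polyX map_polyC /= !hornerE.
apply: (subringD ringA); first exact: AM.
by rewrite -(natr_Zp k) rmorph_nat; apply: subring_nat.
Qed.

(** * Polynomial rings *)

(** The degree measure for [atomic_in_degree] is [(msize b).-1], as [msize] is
    one more than the total degree.  The constants of a subring [S] form a
    subring of [F], whose nonzero elements are then units of [S]. *)
Lemma subrings_are_fields_mpoly (F : fieldType) (n : nat) :
  subrings_are_fields F -> hereditarily_atomic {mpoly F[n]}.
Proof.
move=> subF S ringS; apply: (@atomic_in_degree _ _ (fun b => (msize b).-1)).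
  move=> b c b0 c0; rewrite msizeM //.
  move: b0 c0; rewrite -!msize_poly_eq0.
  by case: (msize b) => // i; case: (msize c) => // j _ _; rewrite addnS.
move=> b Sb b0 degb; have le_b1 : (msize b <= 1)%N.
  by rewrite -subn_eq0 subn1 degb.
have def_b := msize1_polyC le_b1.
move: Sb b0; rewrite def_b mpolyC_eq0 => Sb b0.
have [_ [v Sv bv1]] := subF _ (subring_preimage (@mpolyC n F) ringS) _ Sb b0.
by split=> //; exists v%:MP; rewrite // -mpolyCM bv1 mpolyC1.
Qed.

(** Evaluating an element of [{mpoly F[1]}] at ['X] is a left inverse. *)
Lemma horner_alg_mpoly1_inj (F : fieldType) :
  injective (horner_alg ('X_ord0 : {mpoly F[1]})).
Proof.
apply: (can_inj (g := mmap polyC (fun=> 'X))) => p.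
elim/poly_ind: p => [|p c IHp]; first by rewrite !rmorph0.
rewrite rmorphD rmorphM /= horner_algX horner_algC.
by rewrite rmorphD rmorphM /= IHp alg_mpolyC mmapC mmapX mmap1U.
Qed.

Theorem proposition5p4 (F : fieldType) :
  [<-> (forall n : nat, (0 < n)%N -> hereditarily_atomic {mpoly F[n]});
       hereditarily_atomic {poly F};
       (exists2 p : nat, prime p & algebraic_over_Fp p F)].
Proof.
tfae.
- move=> atomF; apply: hereditarily_atomic_inj (atomF 1%N isT).
  exact: horner_alg_mpoly1_inj.
- by move/hereditarily_atomic_poly_subrings/subrings_are_fields_algebraic.
- case=> p _ /algebraic_subrings_are_fields subF n _.
  exact: subrings_are_fields_mpoly.
Qed.
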